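(* Suppose the following statement (A) holds: for all integers $n\ge r\ge 3$ and $k\ge\binom{r}{2}$, and every $k$-weighted graph $(G_0,f)$ with $G_0\cong K_n$ on vertex set $[n]$ such that $G_0$ contains no copy of $K_r$ having weight sequence bound $(1,2,\dots,\binom{r}{2})$, setting $k_2=\left\lceil\frac{(\binom{r}{2}-1)\binom{n}{2}}{t_{r-1}(n)}\right\rceil$ and $k_1=k_2-1$, we have: (i) if $k=k_1$ then $f(G_0)\le(\binom{r}{2}-1)\binom{n}{2}$; and (ii) if $k=k_2$ then $f(G_0)\le k\cdot t_{r-1}(n)$. Then the following statement (B) holds: for all integers $n\ge r-1\ge 2$ and $k\ge\binom{r}{2}$, $$\mathrm{ex}_k(n, K_r)\le\max\left\{\left(\binom{r}{2}-1\right)\binom{n}{2},\ k\cdot t_{r-1}(n)\right\}.$$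
   Context: $K_r$ is the complete graph on $r$ vertices; $t_{r-1}(n)$ is the number of edges of the Turán graph $T_{r-1}(n)$ (complete $(r-1)$-partite graph on $n$ vertices with part sizes differing by at most one). For an integer $\ell$ and a graph $H$, an $\ell$-weighting of $H$ is a map $g:E(H)\to\{0,1,\dots,\ell\}$, and $(H,g)$ is an $\ell$-weighted graph; for a subgraph $H'$, $g(H')=\sum_{e\in E(H')}g(e)$. The weight sequence of a subgraph $H'$ with $m$ edges is the list $(a_1,\dots,a_m)$ of the weights of its edges arranged in nondecreasing order. A nondecreasing sequence $(b_1,\dots,b_m)$ is a weight sequence bound of $H'$ if $a_i\ge b_i$ for every $i\in[m]$, where $(a_1,\dots,a_m)$ is the weight sequence of $H'$. A multiset $\mathcal{G}_n^k=\{G_1,\dots,G_k\}$ of graphs on $[n]$ is rainbow $K_r$-free if there is no copy of $K_r$ in $K_n$ with edges $e_1,\dots,e_{\binom r2}$ and distinct indices $i_1,\dots,i_{\binom r2}\in[k]$ with $e_j\in G_{i_j}$ for all $j$. $\mathrm{ex}_k(n,K_r)$ is the maximum of $\sum_{i=1}^k|E(G_i)|$ over all rainbow $K_r$-free multisets of $k$ graphs on $[n]$. *)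

(* Defs.v *)
From HB Require Import structures.
From mathcomp Require Import all_boot all_order all_algebra.

Set Implicit Arguments.
Unset Strict Implicit.
Unset Printing Implicit Defensive.

Definition pairs (n : nat) (S : {set 'I_n}) : {set {set 'I_n}} :=
  [set e : {set 'I_n} | (e \subset S) && (#|e| == 2)].

(* Simple graphs on [n] = 'I_n are given by their edge sets; subgraphs are kept
   on the same vertex set, since only edges matter for weights and copies. *)
Record sgraph (n : nat) := SGraph {
  edges :> {set {set 'I_n}};
  edgesP : edges \subset pairs [set: 'I_n]
}.

HB.instance Definition _ (n : nat) := [isSub for @edges n].
HB.instance Definition _ (n : nat) := [Finite of sgraph n by <:].

Lemma complete_on_proof (n : nat) (S : {set 'I_n}) :
  pairs S \subset pairs [set: 'I_n].
Proof. by apply/subsetP=> e; rewrite !inE subsetT => /andP[]. Qed.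

Definition complete_on (n : nat) (S : {set 'I_n}) : sgraph n :=
  SGraph (complete_on_proof S).

Definition complete_graph (n : nat) : sgraph n := complete_on [set: 'I_n].

Definition is_copy_K (r n : nat) (H : sgraph n) (K : sgraph n) : bool :=
  (K \subset H) && [exists S : {set 'I_n}, (#|S| == r) && (K == complete_on S)].

(* Vertex i lies in part i mod p, so the p parts partition [n] and their sizes
   differ by at most one. *)
Definition turan_edges (p n : nat) : {set {set 'I_n}} :=
  [set e in pairs [set: 'I_n] |
    [exists i in e, exists j in e, i %% p != j %% p]].

Lemma turan_proof (p n : nat) : turan_edges p n \subset pairs [set: 'I_n].
Proof. by apply/subsetP=> e; rewrite inE => /andP[]. Qed.

Definition turan_graph (p n : nat) : sgraph n := SGraph (turan_proof p n).

Definition turan_number (p n : nat) : nat := #|turan_graph p n|.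

(* A weighting is a function on all vertex sets, of which only the values on
   the edges of the graph are ever used. *)
Definition is_weighting (l n : nat) (H : sgraph n) (g : {set 'I_n} -> nat) : Prop :=
  forall e : {set 'I_n}, e \in edges H -> g e <= l.

Definition weight (n : nat) (g : {set 'I_n} -> nat) (H : sgraph n) : nat :=
  \sum_(e in edges H) g e.

Definition weight_sequence (n : nat) (g : {set 'I_n} -> nat) (H : sgraph n) : seq nat :=
  sort leq [seq g e | e <- enum (edges H)].

Definition is_weight_sequence_bound (n : nat) (g : {set 'I_n} -> nat)
    (H : sgraph n) (b : seq nat) : Prop :=
  [/\ sorted leq b, size b = #|edges H|
    & forall i : nat, i < #|edges H| -> nth 0 b i <= nth 0 (weight_sequence g H) i].

(* A multiset of k graphs is represented by a family indexed by 'I_k. *)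
Definition rainbow_K_free (r n k : nat) (G : {ffun 'I_k -> sgraph n}) : bool :=
  ~~ [exists K : sgraph n,
      exists e : {ffun 'I_('C(r, 2)) -> {set 'I_n}},
      exists c : {ffun 'I_('C(r, 2)) -> 'I_k},
      [&& is_copy_K r (complete_graph n) K,
          injectiveb e, [set e j | j : 'I_('C(r, 2))] == edges K,
          injectiveb c & [forall j, e j \in edges (G (c j))]]].

Definition ex_K (k n r : nat) : nat :=
  \max_(G : {ffun 'I_k -> sgraph n} | rainbow_K_free r G) \sum_(i < k) #|edges (G i)|.

Definition turan_threshold (r n : nat) : int :=
  Num.ceil (((('C(r, 2) - 1) * 'C(n, 2))%:R / (turan_number r.-1 n)%:R)%R : rat).

(* Main.v *)
(** Weight each pair by the number of graphs of the family containing it. If the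
    j-th lightest edge of a copy of K_r lies in at least j graphs for every j,
    distinct graphs can be picked greedily from the lightest edge on, so the
    weighting of a rainbow K_r-free family satisfies the hypothesis of (A).
    For k <= k_1 it is also a k_1-weighting and (i) applies; for k >= k_2,
    (ii) bounds every subfamily of k_2 graphs, and averaging gives the bound for
    the whole family. As t_{r-1}(n) < C(n, 2) for n >= r, k_2 >= C(r, 2), so
    (A) is applicable; for n = r - 1 the Turan graph is complete. *)

Require Import Defs.
From HB Require Import structures.
From mathcomp Require Import all_boot all_order all_algebra.

Set Implicit Arguments.
Unset Strict Implicit.
Unset Printing Implicit Defensive.

Import Order.TTheory GRing.Theory Num.Theory.

Lemma card_pairs (n : nat) (S : {set 'I_n}) : #|pairs S| = 'C(#|S|, 2).
Proof. exact: cards_draws. Qed.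

Lemma card_edges_le (n : nat) (H : sgraph n) : #|edges H| <= 'C(n, 2).
Proof.
by rewrite -[n in 'C(n, 2)]card_ord -cardsT -card_pairs subset_leq_card ?edgesP.
Qed.

Lemma pair_in_pairs (n : nat) (i j : 'I_n) :
  i != j -> [set i; j] \in pairs [set: 'I_n].
Proof. by move=> neq_ij; rewrite inE subsetT cards2 neq_ij. Qed.

Lemma mem_turan_pair (p n : nat) (i j : 'I_n) :
  ([set i; j] \in turan_edges p n) = (i %% p != j %% p).
Proof.
apply/idP/idP => [|neq_ij].
  rewrite inE => /andP[_ /exists_inP[a + /exists_inP[b]]].
  by rewrite !inE => /orP[]/eqP-> /orP[]/eqP->; rewrite ?eqxx // eq_sym.
rewrite inE pair_in_pairs; last by apply: contraNneq neq_ij => ->.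
apply/exists_inP; exists i; first by rewrite !inE eqxx.
by apply/exists_inP; exists j; rewrite // !inE eqxx orbT.
Qed.

Lemma turan_number_gt0 (p n : nat) : 1 < p -> 1 < n -> 0 < turan_number p n.
Proof.
move=> p_gt1 n_gt1; apply/card_gt0P.
exists [set Ordinal (ltnW n_gt1); Ordinal n_gt1].
by rewrite mem_turan_pair /= mod0n modn_small.
Qed.

Lemma turan_number_lt (p n : nat) : 0 < p < n -> turan_number p n < 'C(n, 2).
Proof.
move=> /andP[p_gt0 lt_pn].
rewrite -[n in 'C(n, 2)]card_ord -cardsT -card_pairs.
apply/proper_card/properP; split; first exact: turan_proof.
(* Vertices [0] and [p] lie in the same part, so their pair is missing from the Turán graph. *)
exists [set Ordinal (ltn_trans p_gt0 lt_pn); Ordinal lt_pn].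
  by rewrite pair_in_pairs // -val_eqE /= neq_ltn p_gt0.
by rewrite mem_turan_pair /= mod0n modnn.
Qed.

(** When [n <= p] every vertex is its own residue mod [p], so no part has two vertices. *)
Lemma turan_number_complete (p n : nat) : n <= p -> turan_number p n = 'C(n, 2).
Proof.
move=> le_np; rewrite -[n in 'C(n, 2)]card_ord -cardsT -card_pairs.
apply: eq_card => e; apply/idP/idP => [|e_pair].
  exact/subsetP/turan_proof.
have /cards2P[i [j [neq_ij def_e]]] : #|e| == 2.
  by move: e_pair; rewrite inE => /andP[].
by rewrite def_e mem_turan_pair !modn_small // (leq_trans (ltn_ord _)).
Qed.

(** [F m] has more than [m] elements, so one of them differs from the [m] representatives already
    chosen. *)
Lemma sdr_of_card_gt (T : finType) (x0 : T) (F : nat -> {set T}) (m : nat) :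
  (forall j, j < m -> j < #|F j|) ->
  exists s : seq T,
    [/\ size s = m, uniq s & forall j, j < m -> nth x0 s j \in F j].
Proof.
elim: m => [|m IHm] F_gt; first by exists [::].
have [j lt_jm|s [size_s uniq_s s_in]] := IHm; first by rewrite F_gt // ltnS ltnW.
have /subsetPn[x Fx s'x] : ~~ (F m \subset s).
  apply: contraL (F_gt m (ltnSn m)) => /subset_leq_card le_F.
  by rewrite -leqNgt (leq_trans le_F) // -size_s card_size.
exists (rcons s x); split; first by rewrite size_rcons size_s.
  by rewrite rcons_uniq s'x.
move=> j; rewrite ltnS leq_eqVlt nth_rcons size_s => /predU1P[->|lt_jm].
  by rewrite ltnn eqxx.
by rewrite lt_jm s_in.
Qed.

(** Counting only inside [A] lets one weighting serve both the whole family and its subfamilies of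
    [k_2] graphs. *)
Definition multiplicity (n k : nat) (G : {ffun 'I_k -> sgraph n})
    (A : {set 'I_k}) (e : {set 'I_n}) : nat :=
  #|[set i in A | e \in edges (G i)]|.

Lemma multiplicity_le (n k : nat) (G : {ffun 'I_k -> sgraph n}) A e :
  multiplicity G A e <= #|A|.
Proof. by apply/subset_leq_card/subsetP => i; rewrite inE => /andP[]. Qed.

(** Double counting of the pairs [(e, i)] with [i] in [A] and [e] an edge of [G i]. *)
Lemma weight_multiplicity (n k : nat) (G : {ffun 'I_k -> sgraph n}) A :
  weight (multiplicity G A) (complete_graph n) = \sum_(i in A) #|edges (G i)|.
Proof.
rewrite /weight /multiplicity.
under eq_bigr => e _ do rewrite -sum1dep_card big_mkcondr.
rewrite exchange_big /=; apply: eq_bigr => i _.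
rewrite -sum1_card -big_mkcondr /=; apply: eq_bigl => e.
by rewrite andb_idl //; apply/subsetP/edgesP.
Qed.

Lemma rainbow_free_no_heavy_copy (r n k : nat) (G : {ffun 'I_k -> sgraph n}) A :
  0 < k -> rainbow_K_free r G ->
  ~ (exists2 K : sgraph n, is_copy_K r (complete_graph n) K &
       is_weight_sequence_bound (multiplicity G A) K (iota 1 'C(r, 2))).
Proof.
move=> k_gt0 /negP-Gfree [K copyK [_ cardK boundK]]; apply: Gfree.
rewrite size_iota in cardK.
set f := multiplicity G A in boundK.
(* Sorting the edges by weight, instead of the weights alone, keeps the edge behind each entry of
   the weight sequence. *)
pose s := sort (relpre f leq) (enum (edges K)).
have size_s : size s = 'C(r, 2) by rewrite size_sort -cardE cardK.
have uniq_s : uniq s by rewrite sort_uniq enum_uniq.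
have mem_s e : (e \in s) = (e \in edges K) by rewrite mem_sort mem_enum.
(* Positions start at 0 but the bound starts at 1, so the inequality is strict, as the greedy choice
   requires. *)
have f_gt j : j < 'C(r, 2) -> j < f (nth set0 s j).
  move=> lt_j; move: (boundK j); rewrite -cardK lt_j => /(_ isT).
  by rewrite nth_iota // add1n /weight_sequence sort_map (nth_map set0) ?size_s.
have [c [size_c uniq_c c_in]] :=
  sdr_of_card_gt (Ordinal k_gt0)
    (F := fun j => [set i in A | nth set0 s j \in edges (G i)]) f_gt.
apply/existsP; exists K.
apply/existsP; exists [ffun j : 'I__ => nth set0 s j].
apply/existsP; exists [ffun j : 'I__ => nth (Ordinal k_gt0) c j].
apply/and5P; split=> //.
- apply/injectiveP => i j; rewrite !ffunE => /eqP.
  by rewrite nth_uniq ?size_s // => /eqP/val_inj.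
- apply/eqP/setP => e; rewrite -mem_s; apply/imsetP/idP => [[j _ ->]|s_e].
    by rewrite ffunE mem_nth ?size_s.
  have lt_e : index e s < 'C(r, 2) by rewrite -size_s index_mem.
  by exists (Ordinal lt_e); rewrite // ffunE nth_index.
- apply/injectiveP => i j; rewrite !ffunE => /eqP.
  by rewrite nth_uniq ?size_c // => /eqP/val_inj.
- apply/forallP => j; rewrite !ffunE.
  by have := c_in j (ltn_ord j); rewrite inE => /andP[].
Qed.

(* Summing the bound for [A :\ j] over all [j] in [A] counts each element of [A]
   exactly [#|A| - 1] times. *)
Lemma sum_le_of_subsets (T : finType) (w : T -> nat) (m t : nat) :
  0 < m ->
  (forall A : {set T}, #|A| = m -> \sum_(i in A) w i <= m * t) ->
  forall A : {set T}, m <= #|A| -> \sum_(i in A) w i <= #|A| * t.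
Proof.
move=> m_gt0 bound_m A; move: {2}(#|A| - m) (erefl (#|A| - m)) => d.
elim: d A => [|d IHd] A def_d le_mA.
  have eqA : #|A| = m by apply/eqP; rewrite eqn_leq le_mA -subn_eq0 def_d /=.
  by rewrite eqA bound_m.
have lt_mA : m < #|A| by rewrite -subn_gt0 def_d.
have A1_gt0 : 0 < #|A|.-1 by rewrite -ltnS (ltn_predK lt_mA) (leq_ltn_trans m_gt0).
set S := \sum_(i in A) w i.
have del_le j : j \in A -> S <= w j + #|A|.-1 * t.
  move=> Aj; have cardAj : #|A :\ j| = #|A|.-1 by rewrite (cardsD1 j A) Aj.
  rewrite /S (big_setD1 j Aj) leq_add2l -cardAj; apply: IHd.
    by rewrite cardAj -subn1 subnAC def_d subn1.
  by rewrite cardAj -ltnS (ltn_predK lt_mA).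
(* The weights [w j] add up to one [S], which cancels one of the [#|A|] copies on the left; the
   positive factor [#|A|.-1] is then divided out. *)
have : \sum_(j in A) S <= \sum_(j in A) (w j + #|A|.-1 * t) by exact: leq_sum.
rewrite big_split /= !sum_nat_const -/S -[X in X * S](ltn_predK lt_mA).
by rewrite mulSn leq_add2l mulnCA leq_pmul2l.
Qed.

Lemma turan_threshold_ge (r n : nat) :
  2 < r <= n -> (Posz 'C(r, 2) <= turan_threshold r n)%R.
Proof.
move=> /andP[r_gt2 le_rn]; rewrite /turan_threshold.
have r1_gt1 : 1 < r.-1 by rewrite -ltnS (ltn_predK r_gt2).
have bin_gt0 : 0 < 'C(r, 2) by rewrite bin_gt0 ltnW.
have t_gt0 : 0 < turan_number r.-1 n.
  by rewrite turan_number_gt0 // (leq_trans _ le_rn) // ltnW.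
have t_lt : turan_number r.-1 n < 'C(n, 2).
  by rewrite turan_number_lt // ltnW //= (ltn_predK r_gt2).
have C_gt0 : 0 < 'C(r, 2) - 1.
  by rewrite subn_gt0; apply: leq_trans (leq_bin2l 2 r_gt2).
(* An integer lies strictly below a ceiling exactly when it lies strictly below the number itself,
   so it suffices that the quotient exceeds ['C(r, 2) - 1]. *)
rewrite -[in Posz _](subnK bin_gt0) PoszD lezD1 ceil_gt_int.
rewrite ltr_pdivlMr ?ltr0n // pmulrn -natrM ltr_nat.
by rewrite ltn_pmul2l.
Qed.

Theorem theorem2p3 :
  (forall (n r k : nat) (f : {set 'I_n} -> nat),
     3 <= r <= n ->
     'C(r, 2) <= k ->
     is_weighting k (complete_graph n) f ->
     ~ (exists2 K : sgraph n, is_copy_K r (complete_graph n) K &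
          is_weight_sequence_bound f K (iota 1 'C(r, 2))) ->
     let k2 : int := turan_threshold r n in
     let k1 : int := (k2 - 1)%R in
     (Posz k = k1 -> weight f (complete_graph n) <= ('C(r, 2) - 1) * 'C(n, 2)) /\
     (Posz k = k2 -> weight f (complete_graph n) <= k * turan_number r.-1 n)) ->
  forall n r k : nat,
    2 <= r.-1 <= n ->
    'C(r, 2) <= k ->
    ex_K k n r <= maxn (('C(r, 2) - 1) * 'C(n, 2)) (k * turan_number r.-1 n).
Proof.
move=> weighted n r k /andP[r1_gt1 le_r1n] le_rk.
have r_gt2 : 2 < r by case: r r1_gt1 {le_r1n le_rk}.
have k_gt0 : 0 < k by apply: leq_trans le_rk; rewrite bin_gt0 ltnW.
apply/bigmax_leqP => G Gfree; rewrite leq_max.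
have [lt_nr|le_rn] := ltnP n r.
  apply/orP; right; rewrite turan_number_complete; last first.
    by rewrite -ltnS (ltn_predK r_gt2).
  rewrite -[k in k * _]card_ord -sum_nat_const.
  by apply: leq_sum => i _; apply: card_edges_le.
have r_le : 2 < r <= n by rewrite r_gt2.
have := turan_threshold_ge r_le.
(* The lower bound on the threshold rules out a negative integer. *)
case def_k2 : (turan_threshold r n) => [k2|//]; rewrite lez_nat => le_rk2.
have k2_gt0 : 0 < k2 by apply: leq_trans le_rk2; rewrite bin_gt0 ltnW.
have no_heavy A := rainbow_free_no_heavy_copy (A := A) k_gt0 Gfree.
have weighting (A : {set 'I_k}) m :
    #|A| <= m -> is_weighting m (complete_graph n) (multiplicity G A).
  by move=> le_Am e _; apply: leq_trans (multiplicity_le G A e) le_Am.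
have sumT : \sum_(i in [set: 'I_k]) #|edges (G i)| = \sum_(i < k) #|edges (G i)|.
  by apply: eq_bigl => i; rewrite in_setT.
have [lt_kk2|le_k2k] := ltnP k k2.
  (* Multiplicities never exceed [k], so (i) covers [k < k_1] too; the same inequality yields
     ['C(r, 2) <= k_1]. *)
  have le_kk1 : k <= k2.-1 by rewrite -ltnS prednK.
  have card_le : #|[set: 'I_k]| <= k2.-1 by rewrite cardsT card_ord.
  have [] := weighted n r k2.-1 _ r_le (leq_trans le_rk le_kk1)
               (weighting _ _ card_le) (no_heavy _).
  move=> + _; rewrite def_k2 -predn_int // => /(_ erefl).
  by rewrite weight_multiplicity sumT => ->.
apply/orP; right; rewrite -[k in k * _]card_ord -cardsT -sumT.
apply: (@sum_le_of_subsets _ _ k2); rewrite ?cardsT ?card_ord // => A cardA.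
have card_le : #|A| <= k2 by rewrite cardA.
have [_] := weighted n r k2 _ r_le le_rk2 (weighting _ _ card_le) (no_heavy _).
by rewrite def_k2 weight_multiplicity; apply.
Qed.
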